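(* Let $f,g:\mathbb{N}\to\mathbb{C}$ be arithmetic functions such that \[ f(n)=\sum_{d\mid n}g(d)\quad\text{for all }n\in\mathbb{N},\qquad \sum_{n=1}^{\infty}\frac{|g(n)|}{n}c^{n}<\infty\ \text{ for all }0<c<1. \] If $\Re(z)>0$ and $0<q<1$, then \[ \prod_{n=1}^{\infty}\left(q^{nz};q^{n}\right)_{\infty}^{g(n)/n}=\exp\left(-\sum_{n=1}^{\infty}\frac{f(n)}{n}\frac{q^{nz}}{1-q^{n}}\right) \] and \[ \prod_{n=1}^{\infty}\left(\frac{\left(q^{n(z+1)};q^{2n}\right)_{\infty}}{\left(q^{nz};q^{2n}\right)_{\infty}}\right)^{g(n)/n}=\exp\left(\sum_{n=1}^{\infty}\frac{f(n)}{n}\frac{q^{nz}}{1+q^{n}}\right). \]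
   Context: For $|q|<1$ and $a\in\mathbb{C}$, $(a;q)_{\infty}=\prod_{j=0}^{\infty}(1-aq^{j})$. For $0<q<1$ and $z\in\mathbb{C}$, $q^{w}=e^{w\log q}$ with real $\log q$. Products with complex exponents are understood via logarithms: $\prod_n A_n^{c_n}$ means $\exp\left(\sum_n c_n\log A_n\right)$, where $\log(a;p)_\infty=\sum_{j\ge0}\log(1-ap^{j})$ and $\log(1-w)=-\sum_{k\ge1}w^{k}/k$ for $|w|<1$ (principal branch); the ratio is handled as the difference of logarithms. *)

(* Defs.v *)
From Stdlib Require Import Reals Lra Lia Arith.
From Coquelicot Require Import Coquelicot.

Open Scope C_scope.

Definition Cexp (w : C) : C :=
  ((exp (Re w) * cos (Im w))%R, (exp (Re w) * sin (Im w))%R).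

(* [q ^ w = e ^ (w log q)], intended for [0 < q]. *)
Definition qpow (q : R) (w : C) : C := Cexp (w * RtoC (ln q)).

(* Sum of a complex series, as a total function; it is meaningful only
   when the series converges, see [CSeries_unique]. *)
Definition CSeries (u : nat -> C) : C :=
  (Series (fun n => Re (u n)), Series (fun n => Im (u n))).

Lemma CSeries_unique (u : nat -> C) (l : C) : is_series u l -> CSeries u = l.
Proof.
intros H.
assert (Hre : forall n, Re (sum_n u n) = sum_n (fun k => Re (u k)) n).
{ induction n as [|n IH]; [now rewrite !sum_O|].
  rewrite !sum_Sn, <- IH; reflexivity. }
assert (Him : forall n, Im (sum_n u n) = sum_n (fun k => Im (u k)) n).
{ induction n as [|n IH]; [now rewrite !sum_O|].
  rewrite !sum_Sn, <- IH; reflexivity. }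
assert (Hl : forall eps : posreal,
  eventually (fun n => Cmod (sum_n u n - l) < eps)%R).
{ intros eps.
  apply (H (fun y => Cmod (y - l) < eps)%R).
  apply (locally_le_locally_norm (V := C_NormedModule)).
  exists eps; intros y Hy; exact Hy. }
rewrite (surjective_pairing l); unfold CSeries; f_equal.
- apply is_series_unique; apply filterlim_locally; intros eps.
  destruct (Hl eps) as [N HN]; exists N; intros n Hn.
  rewrite <- Hre.
  eapply Rle_lt_trans; [|exact (HN n Hn)].
  eapply Rle_trans; [|apply Rmax_Cmod].
  apply Rmax_l.
- apply is_series_unique; apply filterlim_locally; intros eps.
  destruct (Hl eps) as [N HN]; exists N; intros n Hn.
  rewrite <- Him.
  eapply Rle_lt_trans; [|exact (HN n Hn)].
  eapply Rle_trans; [|apply Rmax_Cmod].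
  apply Rmax_r.
Qed.

(* [log (1 - w)], principal branch, for [Cmod w < 1]. *)
Definition log1m (w : C) : C :=
  - CSeries (fun k => w ^ S k / RtoC (INR (S k))).

(* [log (a; p)_oo = sum_(j >= 0) log (1 - a p^j)]. *)
Definition log_qpoch (a p : C) : C := CSeries (fun j => log1m (a * p ^ j)).

(* The logarithms and the series defining [log_qpoch a p] make sense. *)
Definition ex_log_qpoch (a p : C) : Prop :=
  (forall j, Cmod (a * p ^ j) < 1)%R /\
  ex_series (fun j => log1m (a * p ^ j)).

(* [prod_(n >= 1) A_n ^ c_n] converges to [P], the product being understood as
   [exp (sum_(n >= 1) c_n log A_n)]; [logA n] is the chosen [log A_n]. *)
Definition is_prod_cpow (logA c : nat -> C) (P : C) : Prop :=
  exists s : C, is_series (fun n => c (S n) * logA (S n)) s /\ P = Cexp s.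

Definition divisor_sum (g : nat -> C) (n : nat) : C :=
  sum_n_m (fun d => if Nat.eqb (Nat.modulo n d) 0 then g d else RtoC 0) 1 n.

(* Main.v *)
Require Import Defs.
From Stdlib Require Import Reals Lra Lia.
From Coquelicot Require Import Coquelicot.
Open Scope C_scope.

(** The expansion [log (1 - w) = - sum_k w^k / k] and summation of the geometric
    series in [p] give [log (a; p)_oo = - sum_k a^k / (k (1 - p^k))].  With
    [x = q^z] and [h m = x^m / (1 - q^m)], respectively [h m = x^m / (1 + q^m)]
    (which equals [x^m (1 - q^m) / (1 - q^(2m))]), the logarithm of the product
    is therefore, up to sign, [sum_n g(n)/n sum_k h(n k)/k]; grouping the pairs
    [(n, k)] according to [m = n k] turns it into [sum_m f(m)/m h(m)].  Both
    rearrangements are legitimate by absolute convergence: [|h m|] is bounded by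
    a multiple of [|x|^m], and [|x| < 1]. *)

(** * Complex series by real and imaginary parts *)

Lemma im_le_Cmod (c : C) : (Rabs (Im c) <= Cmod c)%R.
Proof.
eapply Rle_trans; [apply Rmax_r | apply Rmax_Cmod].
Qed.

Lemma Re_sum_n (u : nat -> C) (n : nat) :
  Re (sum_n u n) = sum_n (fun k => Re (u k)) n.
Proof.
induction n as [|n IH]; [now rewrite !sum_O|].
rewrite !sum_Sn, <- IH; reflexivity.
Qed.

Lemma Im_sum_n (u : nat -> C) (n : nat) :
  Im (sum_n u n) = sum_n (fun k => Im (u k)) n.
Proof.
induction n as [|n IH]; [now rewrite !sum_O|].
rewrite !sum_Sn, <- IH; reflexivity.
Qed.

(** Each component is bounded by the modulus; conversely, balls of [C] as a product space are tested
    componentwise. *)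
Lemma is_series_C_iff (u : nat -> C) (l : C) :
  is_series u l <->
  is_series (fun n => Re (u n)) (Re l) /\ is_series (fun n => Im (u n)) (Im l).
Proof.
split.
- intros H.
  assert (Hl : forall eps : posreal,
    eventually (fun n => Cmod (sum_n u n - l) < eps)%R).
  { intros eps.
    apply (H (fun y => Cmod (y - l) < eps)%R).
    apply (locally_le_locally_norm (V := C_NormedModule)).
    exists eps; intros y Hy; exact Hy. }
  split; apply filterlim_locally; intros eps;
    destruct (Hl eps) as [N HN]; exists N; intros n Hn.
  + rewrite <- Re_sum_n.
    eapply Rle_lt_trans; [|exact (HN n Hn)].
    exact (re_le_Cmod (sum_n u n - l)).
  + rewrite <- Im_sum_n.
    eapply Rle_lt_trans; [|exact (HN n Hn)].
    exact (im_le_Cmod (sum_n u n - l)).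
- intros [Hr Hi]; apply filterlim_locally; intros eps.
  destruct (proj1 (filterlim_locally _ _) Hr eps) as [N1 H1].
  destruct (proj1 (filterlim_locally _ _) Hi eps) as [N2 H2].
  exists (Nat.max N1 N2); intros n Hn; split.
  + specialize (H1 n ltac:(lia)); rewrite <- Re_sum_n in H1; exact H1.
  + specialize (H2 n ltac:(lia)); rewrite <- Im_sum_n in H2; exact H2.
Qed.

Lemma ex_series_Cmod (u : nat -> C) :
  ex_series (fun n => Cmod (u n)) -> ex_series u.
Proof.
intros H.
assert (Hr : ex_series (fun n => Re (u n))).
{ apply (@ex_series_le R_AbsRing R_CompleteNormedModule _ (fun n => Cmod (u n))); [|exact H].
  intros n; apply re_le_Cmod. }
assert (Hi : ex_series (fun n => Im (u n))).
{ apply (@ex_series_le R_AbsRing R_CompleteNormedModule _ (fun n => Cmod (u n))); [|exact H].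
  intros n; apply im_le_Cmod. }
destruct Hr as [a Ha], Hi as [b Hb]; exists (a, b).
now apply is_series_C_iff.
Qed.

(** * Interchange of the order of summation *)

Lemma is_series_Rabs_le (a b : nat -> R) (la lb : R) :
  (forall n, (Rabs (a n) <= b n)%R) -> is_series a la -> is_series b lb ->
  (Rabs la <= lb)%R.
Proof.
intros Hab Ha Hb.
assert (Hex : ex_series (fun n => Rabs (a n))).
{ apply (@ex_series_le R_AbsRing R_CompleteNormedModule _ b); [|now exists lb].
  intros n; change (Rabs (Rabs (a n)) <= b n)%R; now rewrite Rabs_Rabsolu. }
rewrite <- (is_series_unique _ _ Ha), <- (is_series_unique _ _ Hb).
eapply Rle_trans; [now apply Series_Rabs|].
apply Series_le; [|now exists lb].
intros n; split; [apply Rabs_pos | apply Hab].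
Qed.

(* Tannery's argument: the difference between [sum_(j <= J) t j] and the sum of
   [s] is [sum_i (sum_(j <= J) u i j - s i)]; its terms are dominated by
   [2 V i] and each of them tends to 0 with [J]. *)
Lemma is_series_exchange_R (u v : nat -> nat -> R) (s t V : nat -> R) :
  (forall i j, (Rabs (u i j) <= v i j)%R) ->
  (forall i, is_series (v i) (V i)) -> ex_series V ->
  (forall i, is_series (u i) (s i)) ->
  (forall j, is_series (fun i => u i j) (t j)) ->
  exists l : R, is_series s l /\ is_series t l.
Proof.
intros Huv Hv HV Hs Ht.
assert (HsV : forall i, (Rabs (s i) <= V i)%R).
{ intros i; exact (is_series_Rabs_le _ _ _ _ (Huv i) (Hs i) (Hv i)). }
assert (HpV : forall i J, (Rabs (sum_n (u i) J) <= V i)%R).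
{ intros i J.
  eapply Rle_trans; [apply (norm_sum_n_m (u i))|].
  eapply Rle_trans; [apply (sum_n_m_le _ (v i)); intros k; apply Huv|].
  (* The entries [v i j] dominate absolute values, so the partial sums of a row increase to [V i]
     and never exceed it. *)
  apply (is_lim_seq_incr_compare (sum_n (v i)) (V i) (Hv i)).
  intros n; rewrite sum_Sn; unfold plus; simpl.
  pose proof (Rabs_pos (u i (S n))); specialize (Huv i (S n)); lra. }
assert (Hl : exists l : R, is_series s l)
  by exact (@ex_series_le R_AbsRing R_CompleteNormedModule s V HsV HV).
destruct Hl as [l Hl].
exists l; split; [exact Hl|].
set (d := fun J i => (sum_n (u i) J - s i)%R).
assert (Hcol : forall J, is_series (fun i => sum_n (u i) J) (sum_n t J)).
{ induction J as [|J IH].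
  - rewrite sum_O; eapply is_series_ext; [|apply Ht].
    intros i; now rewrite sum_O.
  - rewrite sum_Sn; eapply is_series_ext; [|exact (is_series_plus _ _ _ _ IH (Ht (S J)))].
    intros i; now rewrite sum_Sn. }
assert (Hd : forall J, is_series (d J) (sum_n t J - l)%R).
{ intros J; exact (is_series_minus _ _ _ _ (Hcol J) Hl). }
assert (Hfin : forall N, is_lim_seq (fun J => sum_n (d J) N) 0).
{ assert (H0 : forall i, is_lim_seq (fun J => d J i) 0).
  { intros i; unfold d.
    replace (Finite 0) with (Finite (s i - s i)) by (f_equal; ring).
    apply is_lim_seq_minus'; [apply Hs | apply is_lim_seq_const]. }
  induction N as [|N IH].
  - eapply is_lim_seq_ext; [|apply (H0 O)]. intros J; now rewrite sum_O.
  - replace (Finite 0) with (Finite (0 + 0)) by (f_equal; ring).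
    eapply is_lim_seq_ext; [|apply is_lim_seq_plus'; [apply IH | apply (H0 (S N))]].
    intros J; now rewrite sum_Sn. }
destruct HV as [W HW].
assert (HW2 : is_series (fun i => 2 * V i)%R (2 * W)%R)
  by exact (is_series_scal 2%R V W HW).
apply filterlim_locally; intros eps.
(* A quarter of [eps]: the tail beyond [N] is at most twice the remainder of [V], hence below
   [eps / 2], and the terms up to [N] get the other half. *)
destruct (proj1 (filterlim_locally _ _) HW (pos_div_2 (pos_div_2 eps))) as [N HN].
specialize (HN N (le_n N)).
destruct (proj2 (is_lim_seq_spec _ _) (Hfin N) (pos_div_2 eps)) as [J0 HJ].
exists J0; intros J HJJ; specialize (HJ J HJJ).
change (Rabs (sum_n t J - l) < eps)%R.
change (Rabs (sum_n V N - W) < eps / 2 / 2)%R in HN.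
simpl in HJ; rewrite Rminus_0_r in HJ.
assert (Htail : (Rabs (sum_n t J - l - sum_n (d J) N) <= 2 * W - 2 * sum_n V N)%R).
{ apply (is_series_Rabs_le (fun k => d J (S N + k)%nat) (fun k => 2 * V (S N + k)%nat)%R).
  - intros k; unfold d.
    specialize (HsV (S N + k)%nat); specialize (HpV (S N + k)%nat J).
    eapply Rle_trans; [apply Rabs_triang|]; rewrite Rabs_Ropp; lra.
  - apply is_series_incr_n; [lia|].
    replace (plus _ _) with (sum_n t J - l)%R; [apply Hd|].
    change (sum_n t J - l = sum_n t J - l - sum_n (d J) N + sum_n (d J) N)%R; ring.
  - apply (is_series_incr_n (fun k => 2 * V k)%R); [lia|].
    replace (plus _ _) with (2 * W)%R; [exact HW2|].
    assert (E : sum_n (fun k => 2 * V k)%R N = (2 * sum_n V N)%R)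
      by exact (sum_n_mult_l (K := R_Ring) 2%R V N).
    change (2 * W = 2 * W - 2 * sum_n V N + sum_n (fun k => 2 * V k)%R N)%R.
    rewrite E; ring. }
apply Rabs_def2 in HN; apply Rabs_def2 in HJ; apply Rabs_le_between in Htail.
apply Rabs_def1; lra.
Qed.

(** The real and imaginary parts obey the same majorant [v], so the real statement applies to each
    of them. *)
Lemma is_series_exchange (u : nat -> nat -> C) (v : nat -> nat -> R)
    (s t : nat -> C) (V : nat -> R) :
  (forall i j, (Cmod (u i j) <= v i j)%R) ->
  (forall i, is_series (v i) (V i)) -> ex_series V ->
  (forall i, is_series (u i) (s i)) ->
  (forall j, is_series (fun i => u i j) (t j)) ->
  exists l : C, is_series s l /\ is_series t l.
Proof.
intros Huv Hv HV Hs Ht.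
destruct (is_series_exchange_R (fun i j => Re (u i j)) v
  (fun i => Re (s i)) (fun j => Re (t j)) V) as [a [Ha1 Ha2]]; trivial.
- intros i j; eapply Rle_trans; [apply re_le_Cmod | apply Huv].
- intros i; now apply is_series_C_iff.
- intros j; now apply (is_series_C_iff (fun i => u i j)).
- destruct (is_series_exchange_R (fun i j => Im (u i j)) v
    (fun i => Im (s i)) (fun j => Im (t j)) V) as [b [Hb1 Hb2]]; trivial.
  + intros i j; eapply Rle_trans; [apply im_le_Cmod | apply Huv].
  + intros i; now apply is_series_C_iff.
  + intros j; now apply (is_series_C_iff (fun i => u i j)).
  + exists (a, b); split; now apply is_series_C_iff.
Qed.

(** * Geometric series, finite sums and sums over multiples *)

Lemma is_series_geom_C (p : C) :
  (Cmod p < 1)%R -> is_series (fun n => p ^ n) (/ (1 - p)).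
Proof.
intros Hp.
assert (Hp1 : 1 - p <> 0).
{ intros E; assert (E' : p = 1) by (replace p with (1 - (1 - p)) by ring; rewrite E; ring).
  rewrite E', Cmod_1 in Hp; lra. }
assert (Hex : exists l : C, is_series (fun n => p ^ n) l).
{ apply ex_series_Cmod; exists (/ (1 - Cmod p))%R.
  eapply is_series_ext; [intros n; symmetry; apply Cmod_pow|].
  apply is_series_geom; now rewrite Rabs_pos_eq by apply Cmod_ge_0. }
destruct Hex as [l Hl].
(* The shifted series is summed twice, by dropping the first term and by factoring out [p]; thus
   [l - 1 = p * l], which determines [l]. *)
assert (H1 : is_series (fun n => p ^ S n) (l - 1)).
{ apply (is_series_incr_1 (fun n => p ^ n)).
  replace (plus _ _) with l; [exact Hl|].
  change (l = l - 1 + 1); ring. }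
assert (H2 : is_series (fun n => p ^ S n) (p * l)) by exact (is_series_scal p _ _ Hl).
apply CSeries_unique in H1; apply CSeries_unique in H2.
replace (/ (1 - p)) with l; [exact Hl|].
rewrite H1 in H2.
assert (E : l * (1 - p) = 1) by (replace (l * (1 - p)) with (l - p * l) by ring; rewrite <- H2; ring).
replace l with (l * (1 - p) / (1 - p)) by (field; exact Hp1).
rewrite E; field; exact Hp1.
Qed.

Lemma is_series_finite {K : AbsRing} {V : NormedModule K} (a : nat -> V) (N : nat) :
  (forall n, (N < n)%nat -> a n = zero) -> is_series a (sum_n a N).
Proof.
intros Ha.
apply (filterlim_ext_loc (fun _ => sum_n a N)); [|apply filterlim_const].
exists N; intros n Hn; induction Hn as [|n Hn IH]; [easy|].
rewrite sum_Sn, <- IH, (Ha (S n)) by lia; now rewrite plus_zero_r.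
Qed.

(** Passing from [n] to [S n] raises the quotient by one exactly when [d] divides [S n], which is
    also when a new term enters on the left. *)
Lemma sum_n_multiples {G : AbelianMonoid} (a : nat -> G) (d n : nat) :
  d <> 0%nat ->
  sum_n (fun m => if Nat.eqb (m mod d) 0 then a (m / d)%nat else zero) n =
  sum_n a (n / d).
Proof.
intros Hd; induction n as [|n IH].
- rewrite Nat.Div0.div_0_l, !sum_O, Nat.Div0.mod_0_l, Nat.Div0.div_0_l; reflexivity.
- rewrite sum_Sn, IH.
  pose proof (Nat.div_mod_eq n d) as En.
  pose proof (Nat.mod_upper_bound n d Hd) as Hn.
  destruct (Nat.eq_dec (S (n mod d)) d) as [E|E].
  + assert (EQ : (S n / d = S (n / d))%nat)
      by (symmetry; apply (Nat.div_unique _ _ _ 0); lia).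
    assert (ER : (S n mod d = 0)%nat)
      by (symmetry; apply (Nat.mod_unique _ _ (S (n / d))); lia).
    rewrite EQ, ER, sum_Sn; reflexivity.
  + assert (EQ : (S n / d = n / d)%nat)
      by (symmetry; apply (Nat.div_unique _ _ _ (S (n mod d))); lia).
    assert (ER : (S n mod d = S (n mod d))%nat)
      by (symmetry; apply (Nat.mod_unique _ _ (n / d)); lia).
    rewrite EQ, ER; simpl; now rewrite plus_zero_r.
Qed.

(** Padding with zeros only slows the partial sums down: they are those of [a] at [n / d], which
    tends to infinity. *)
Lemma is_series_multiples {K : AbsRing} {V : NormedModule K} (a : nat -> V)
    (d : nat) (l : V) :
  d <> 0%nat -> is_series (fun k => a (S k)) l ->
  is_series (fun m => if Nat.eqb (S m mod d) 0 then a (S m / d)%nat else zero) l.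
Proof.
intros Hd Ha.
(* Index 0 is restored to make [sum_n_multiples] applicable. As a multiple of [d] it contributes
   [a 0], which [is_series_decr_1] removes again below. *)
apply (is_series_incr_1 (fun m => if Nat.eqb (m mod d) 0 then a (m / d)%nat else zero)).
rewrite Nat.Div0.mod_0_l, Nat.Div0.div_0_l; change (Nat.eqb 0 0) with true; cbv iota.
apply (filterlim_ext (fun n => sum_n a (n / d))).
{ intros n; symmetry; now apply sum_n_multiples. }
apply (filterlim_comp _ _ _ (fun n => (n / d)%nat) (sum_n a) _ eventually).
- intros P [N HN]; exists (d * N)%nat; intros n Hn; apply HN.
  apply Nat.div_le_lower_bound; lia.
- apply is_series_decr_1.
  replace (plus (plus l (a 0%nat)) (opp (a 0%nat))) with l; [exact Ha|].
  symmetry; rewrite <- (plus_assoc (G := NormedModule.AbelianMonoid K V)).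
  rewrite (plus_opp_r (G := NormedModule.AbelianGroup K V)).
  exact (plus_zero_r (G := NormedModule.AbelianMonoid K V) l).
Qed.

(** * Elementary estimates and the expansion of the logarithms *)

Lemma Copp_involutive (w : C) : - - w = w.
Proof. ring. Qed.

(* [is_series_ext] on [C] leaves equations in the carrier of [C_NormedModule],
   which [ring] and [field] do not recognise. *)
Lemma is_series_ext_C (a b : nat -> C) (l : C) :
  (forall n, a n = b n) -> is_series a l -> is_series b l.
Proof. exact (is_series_ext a b l). Qed.

Lemma is_series_pow_S (r : R) :
  (0 <= r < 1)%R -> is_series (fun k => r ^ S k)%R (r / (1 - r))%R.
Proof.
intros Hr; exact (is_series_scal r _ _ (is_series_geom r (Rabs_def1 r 1 ltac:(lra) ltac:(lra)))).
Qed.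

Lemma pow_le_self (r : R) (n : nat) : (0 <= r <= 1)%R -> (r ^ S n <= r)%R.
Proof.
intros Hr; simpl.
assert (r ^ n <= 1)%R by (rewrite <- (pow1 n); now apply pow_incr).
nra.
Qed.

Lemma RtoC_INR_S_neq_0 (n : nat) : RtoC (INR (S n)) <> 0.
Proof.
intros H; apply RtoC_inj in H; exact (not_0_INR (S n) ltac:(lia) H).
Qed.

Lemma Cmod_div_INR_S (w : C) (n : nat) :
  Cmod (w / RtoC (INR (S n))) = (Cmod w / INR (S n))%R.
Proof.
rewrite Cmod_div by apply RtoC_INR_S_neq_0.
now rewrite Cmod_R, Rabs_pos_eq by apply pos_INR.
Qed.

Lemma Cmod_div_INR_S_le (w : C) (n : nat) :
  (Cmod (w / RtoC (INR (S n))) <= Cmod w)%R.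
Proof.
rewrite Cmod_div_INR_S.
apply Rle_div_l; [apply lt_0_INR; lia|].
rewrite <- (Rmult_1_r (Cmod w)) at 1.
apply Rmult_le_compat_l; [apply Cmod_ge_0|].
apply (le_INR 1); lia.
Qed.

Lemma Cmod_pow_lt_1 (p : C) (n : nat) : (Cmod p < 1)%R -> (Cmod (p ^ S n) < 1)%R.
Proof.
intros Hp; rewrite Cmod_pow.
eapply Rle_lt_trans; [apply pow_le_self|exact Hp].
split; [apply Cmod_ge_0 | lra].
Qed.

(** Comparison with the geometric series of [Cmod w] gives convergence, so the total function
    [CSeries] in [log1m] is the true sum. *)
Lemma is_series_log1m (w : C) : (Cmod w < 1)%R ->
  is_series (fun k => w ^ S k / RtoC (INR (S k))) (- log1m w).
Proof.
intros Hw.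
destruct (ex_series_Cmod (fun k => w ^ S k / RtoC (INR (S k)))) as [l Hl].
{ apply (@ex_series_le R_AbsRing R_CompleteNormedModule _ (fun k => Cmod w ^ S k)%R).
  - intros k; change (norm ?x) with (Rabs x).
    rewrite Rabs_pos_eq by apply Cmod_ge_0.
    rewrite <- Cmod_pow; apply Cmod_div_INR_S_le.
  - eexists; apply is_series_pow_S; split; [apply Cmod_ge_0 | exact Hw]. }
unfold log1m; rewrite (CSeries_unique _ _ Hl), Copp_involutive; exact Hl.
Qed.

(** Expand every [log (1 - a p^j)] in powers and sum over [j] first: the powers [p^(j(k+1))] form a
    geometric series with sum [1 / (1 - p^(k+1))]. *)
Lemma log_qpoch_series (a p : C) : (Cmod a < 1)%R -> (Cmod p < 1)%R ->
  ex_log_qpoch a p /\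
  is_series (fun k => a ^ S k / RtoC (INR (S k)) / (1 - p ^ S k))
    (- log_qpoch a p).
Proof.
intros Ha Hp.
pose proof (Cmod_ge_0 a) as Ha0; pose proof (Cmod_ge_0 p) as Hp0.
assert (Hp1 : forall j, (0 <= Cmod p ^ j <= 1)%R).
{ intros j; split; [now apply pow_le|].
  rewrite <- (pow1 j); apply pow_incr; lra. }
assert (Hap : forall j, (Cmod (a * p ^ j) < 1)%R).
{ intros j; rewrite Cmod_mult, Cmod_pow; specialize (Hp1 j); nra. }
(* In the majorant only one of the [k + 1] factors [|p|^j] is kept; this suffices, since its row
   sums are geometric in [j]. *)
destruct (is_series_exchange
  (fun j k => (a * p ^ j) ^ S k / RtoC (INR (S k)))
  (fun j k => Cmod p ^ j * Cmod a ^ S k)%R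
  (fun j => - log1m (a * p ^ j))
  (fun k => a ^ S k / RtoC (INR (S k)) / (1 - p ^ S k))
  (fun j => Cmod p ^ j * (Cmod a / (1 - Cmod a)))%R) as [l [H1 H2]].
- intros j k; eapply Rle_trans; [apply Cmod_div_INR_S_le|].
  rewrite Cmod_pow, Cmod_mult, Cmod_pow, Rpow_mult_distr, Rmult_comm.
  apply Rmult_le_compat_r; [now apply pow_le | now apply pow_le_self].
- intros j; exact (is_series_scal (Cmod p ^ j)%R _ _
    (is_series_pow_S (Cmod a) (conj Ha0 Ha))).
- eexists; apply is_series_scal_r, is_series_geom.
  now rewrite Rabs_pos_eq.
- intros j; now apply is_series_log1m.
- intros k.
  eapply is_series_ext_C; [|exact (is_series_scal (a ^ S k / RtoC (INR (S k))) _ _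
    (is_series_geom_C _ (Cmod_pow_lt_1 p k Hp)))].
  intros j; change (scal ?x ?y) with (x * y).
  rewrite Cpow_mult_l, <- !Cpow_mult_r, (Nat.mul_comm (S k)).
  unfold Cdiv; ring.
- assert (H3 : is_series (fun j => log1m (a * p ^ j)) (- l)).
  { eapply is_series_ext_C; [|exact (is_series_opp _ _ H1)].
    intros j; apply Copp_involutive. }
  split; [split; [exact Hap | now exists (- l)]|].
  unfold log_qpoch; rewrite (CSeries_unique _ _ H3), Copp_involutive; exact H2.
Qed.

(** * Rearrangement of Lambert series along divisors *)

(* Both sides are the sum over all pairs [(n, m)] with [n] dividing [m] of
   [g n * h m / m], computed by rows and by columns. *)
Lemma lambert_rearrangement (f g h L : nat -> C) (r K : R) :
  (forall n, (1 <= n)%nat -> f n = divisor_sum g n) ->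
  (0 < r < 1)%R ->
  ex_series (fun n => Cmod (g (S n)) / INR (S n) * r ^ S n)%R ->
  (forall m, (Cmod (h (S m)) <= K * r ^ S m)%R) ->
  (forall n, is_series (fun k => h (S n * S k)%nat / RtoC (INR (S k))) (L (S n))) ->
  exists s : C,
    is_series (fun n => f (S n) / RtoC (INR (S n)) * h (S n)) s /\
    is_series (fun n => g (S n) / RtoC (INR (S n)) * L (S n)) s.
Proof.
intros Hfg Hr Hg Hh HL.
assert (HK : (0 <= K)%R).
{ specialize (Hh 0%nat); pose proof (Cmod_ge_0 (h 1%nat)).
  rewrite pow_1 in Hh; nra. }
(* With [m = (n + 1) k], the denominators [n + 1] and [k] of the two nested sums multiply to [m]. *)
set (w := fun n m => g (S n) / RtoC (INR m) * h m).
set (G := fun n => (Cmod (g (S n)) / INR (S n) * K)%R).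
assert (HG : forall n, (0 <= G n)%R).
{ intros n; unfold G; apply Rmult_le_pos; [|exact HK].
  apply Rdiv_le_0_compat; [apply Cmod_ge_0 | apply lt_0_INR; lia]. }
assert (Hrn : forall n, (0 <= r ^ S n < 1)%R).
{ intros n; split; [apply pow_le; lra|].
  eapply Rle_lt_trans; [apply pow_le_self; lra | lra]. }
assert (Hmul : forall n m, (S m mod S n = 0)%nat -> S m = (S n * (S m / S n))%nat).
{ intros n m E; pose proof (Nat.div_mod_eq (S m) (S n)); lia. }
(* Rows are indexed by the divisor, columns by the multiple. Writing [S m] as [S n * (S m / S n)]
   makes each row an instance of [is_series_multiples], also for the majorant, whose rows are
   geometric of ratio [r ^ S n]. *)
destruct (is_series_exchange
  (fun n m => if Nat.eqb (S m mod S n) 0 then w n (S n * (S m / S n))%nat else RtoC 0)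
  (fun n m => if Nat.eqb (S m mod S n) 0 then (G n * (r ^ S n) ^ (S m / S n))%R else 0%R)
  (fun n => g (S n) / RtoC (INR (S n)) * L (S n))
  (fun m => f (S m) / RtoC (INR (S m)) * h (S m))
  (fun n => G n * (r ^ S n / (1 - r ^ S n)))%R) as [s [H1 H2]].
- intros n m; destruct (Nat.eqb_spec (S m mod S n) 0) as [E|E].
  + rewrite <- pow_mult.
    rewrite <- (Hmul _ _ E); unfold w, G.
    rewrite Cmod_mult, Cmod_div_INR_S.
    rewrite Rmult_assoc.
    apply Rmult_le_compat; [|apply Cmod_ge_0| |apply Hh].
    * apply Rdiv_le_0_compat; [apply Cmod_ge_0 | apply lt_0_INR; lia].
    * apply Rmult_le_compat_l; [apply Cmod_ge_0|].
      (* The majorant has [1 / S n] in place of [1 / S m]; a divisor of [S m] is at most [S m]. *)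
      apply Rinv_le_contravar; [apply lt_0_INR; lia|].
      apply le_INR; apply Nat.Div0.mod_divides in E.
      destruct E as [c Ec]; destruct c; nia.
  + rewrite Cmod_0; apply Rle_refl.
- intros n.
  apply (is_series_multiples (V := R_NormedModule) (fun k => G n * (r ^ S n) ^ k)%R); [lia|].
  exact (is_series_scal (G n) _ _ (is_series_pow_S _ (Hrn n))).
(* As [1 - r ^ S n >= 1 - r], the row sums are dominated by a constant multiple of the series in
   [Hg]. *)
- apply (@ex_series_le R_AbsRing R_CompleteNormedModule _
    (fun n => Cmod (g (S n)) / INR (S n) * r ^ S n * (K / (1 - r)))%R).
  + intros n; change (norm ?x) with (Rabs x).
    assert (Hn : (0 < 1 - r <= 1 - r ^ S n)%R).
    { pose proof (pow_le_self r n ltac:(lra)); lra. }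
    rewrite Rabs_pos_eq.
    * replace (_ * _ * (K / (1 - r)))%R with (G n * (r ^ S n / (1 - r)))%R
        by (unfold G, Rdiv; ring).
      apply Rmult_le_compat_l; [apply HG|].
      apply Rmult_le_compat_l; [apply Hrn|].
      apply Rinv_le_contravar; lra.
    * apply Rmult_le_pos; [apply HG|].
      apply Rdiv_le_0_compat; [apply Hrn | lra].
  + destruct Hg as [l Hl]; eexists; apply is_series_scal_r; exact Hl.
- intros n.
  apply (is_series_multiples (V := C_NormedModule) (fun k => w n (S n * k)%nat)); [lia|].
  eapply is_series_ext_C; [|exact (is_series_scal (g (S n) / RtoC (INR (S n))) _ _ (HL n))].
  intros k; change (scal ?x ?y) with (x * y); unfold w.
  rewrite mult_INR, RtoC_mult.
  field; split; apply RtoC_INR_S_neq_0.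
(* A column is a finite sum: the factor [c] depends on [m] alone, and what remains is the divisor
   sum of [g] at [S m]. *)
- intros m.
  rewrite Hfg by lia.
  set (c := / RtoC (INR (S m)) * h (S m)).
  replace (divisor_sum g (S m) / RtoC (INR (S m)) * h (S m))
    with (c * divisor_sum g (S m)) by (unfold c, Cdiv; ring).
  apply is_series_ext_C with
    (fun n => c * (if Nat.eqb (S m mod S n) 0 then g (S n) else RtoC 0)).
  { intros n; destruct (Nat.eqb_spec (S m mod S n) 0) as [E|E]; [|ring].
    rewrite <- (Hmul _ _ E); unfold w, c, Cdiv; ring. }
  apply (is_series_scal c (V := C_NormedModule)).
  unfold divisor_sum; rewrite <- sum_n_m_S.
  apply (is_series_finite (V := C_NormedModule)
    (fun n => if Nat.eqb (S m mod S n) 0 then g (S n) else RtoC 0)).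
  (* For [n > m] the remainder of [S m] modulo [S n] is [S m] itself, hence nonzero. *)
  intros n Hn; rewrite Nat.mod_small by lia; reflexivity.
- now exists s.
Qed.

(** * The complex exponential and powers of [q] *)

Lemma Cexp_add (a b : C) : Cexp (a + b) = Cexp a * Cexp b.
Proof.
destruct a as [a1 a2], b as [b1 b2]; unfold Cexp, Cmult; simpl.
rewrite exp_plus, cos_plus, sin_plus; f_equal; ring.
Qed.

Lemma Cexp_0 : Cexp 0 = 1.
Proof.
unfold Cexp; simpl; rewrite exp_0, cos_0, sin_0.
apply injective_projections; simpl; ring.
Qed.

Lemma Cmod_Cexp (w : C) : Cmod (Cexp w) = exp (Re w).
Proof.
unfold Cmod, Cexp; simpl.
pose proof (sin2_cos2 (Im w)) as H; unfold Rsqr in H.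
replace (_ + _)%R with (exp (Re w) * exp (Re w) *
  (sin (Im w) * sin (Im w) + cos (Im w) * cos (Im w)))%R by ring.
rewrite H, Rmult_1_r; apply sqrt_square, Rlt_le, exp_pos.
Qed.

Lemma qpow_nat_mul (q : R) (n : nat) (w : C) :
  qpow q (RtoC (INR n) * w) = qpow q w ^ n.
Proof.
induction n as [|n IH].
- unfold qpow; simpl; rewrite !Cmult_0_l; apply Cexp_0.
- rewrite Cpow_S, <- IH, S_INR, RtoC_plus; unfold qpow.
  rewrite <- Cexp_add; f_equal; ring.
Qed.

Lemma qpow_add_1 (q : R) (w : C) : (0 < q)%R -> qpow q (w + 1) = qpow q w * RtoC q.
Proof.
intros Hq; unfold qpow; rewrite Cmult_plus_distr_r, Cexp_add; f_equal.
rewrite Cmult_1_l; unfold Cexp, RtoC; simpl.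
rewrite exp_ln, cos_0, sin_0 by exact Hq; f_equal; ring.
Qed.

(** The modulus is [exp (Re z * ln q)], and [ln q] is negative. *)
Lemma Cmod_qpow_lt_1 (q : R) (z : C) :
  (0 < Re z)%R -> (0 < q < 1)%R -> (0 < Cmod (qpow q z) < 1)%R.
Proof.
intros Hz Hq; unfold qpow; rewrite Cmod_Cexp; split; [apply exp_pos|].
rewrite <- exp_0; apply exp_increasing.
assert (ln q < 0)%R by (rewrite <- ln_1; apply ln_increasing; lra).
unfold Re in *; simpl; nra.
Qed.

(* Stdlib reals with Coquelicot; the values [f 0] and [g 0] play no role. *)
Theorem theorem2p1 (f g : nat -> C)
  (Hfg : forall n : nat, (1 <= n)%nat -> f n = divisor_sum g n)
  (Hg : forall c : R, (0 < c < 1)%R ->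
     ex_series (fun n => Cmod (g (S n)) / INR (S n) * c ^ S n)%R)
  (z : C) (Hz : (0 < Re z)%R) (q : R) (Hq : (0 < q < 1)%R) :
  ((forall n : nat, (1 <= n)%nat ->
      ex_log_qpoch (qpow q (RtoC (INR n) * z)) (RtoC q ^ n)) /\
   exists s : C,
     is_series (fun n => f (S n) / RtoC (INR (S n)) *
       (qpow q (RtoC (INR (S n)) * z) / (1 - RtoC q ^ S n))) s /\
     is_prod_cpow
       (fun n => log_qpoch (qpow q (RtoC (INR n) * z)) (RtoC q ^ n))
       (fun n => g n / RtoC (INR n))
       (Cexp (- s)))
  /\
  ((forall n : nat, (1 <= n)%nat ->
      ex_log_qpoch (qpow q (RtoC (INR n) * (z + 1))) (RtoC q ^ (2 * n)) /\
      ex_log_qpoch (qpow q (RtoC (INR n) * z)) (RtoC q ^ (2 * n))) /\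
   exists s : C,
     is_series (fun n => f (S n) / RtoC (INR (S n)) *
       (qpow q (RtoC (INR (S n)) * z) / (1 + RtoC q ^ S n))) s /\
     is_prod_cpow
       (fun n => log_qpoch (qpow q (RtoC (INR n) * (z + 1))) (RtoC q ^ (2 * n))
                 - log_qpoch (qpow q (RtoC (INR n) * z)) (RtoC q ^ (2 * n)))
       (fun n => g n / RtoC (INR n))
       (Cexp s)).
Proof.
set (x := qpow q z).
assert (Hx : (0 < Cmod x < 1)%R) by now apply Cmod_qpow_lt_1.
assert (Hqm : Cmod (RtoC q) = q) by (rewrite Cmod_R; apply Rabs_pos_eq; lra).
assert (Hq1 : (Cmod (RtoC q) < 1)%R) by (rewrite Hqm; lra).
assert (Hqn : forall n, (Cmod (RtoC q ^ S n) < 1)%R) by (intros n; now apply Cmod_pow_lt_1).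
assert (Hxn : forall n, (Cmod (x ^ S n) < 1)%R) by (intros n; now apply Cmod_pow_lt_1).
assert (Hz' : forall n, qpow q (RtoC (INR n) * z) = x ^ n) by (intros n; apply qpow_nat_mul).
assert (Hz1 : forall n, qpow q (RtoC (INR n) * (z + 1)) = x ^ n * RtoC q ^ n).
{ intros n; rewrite qpow_nat_mul, qpow_add_1 by lra; apply Cpow_mult_l. }
assert (Hxqn : forall n, (Cmod (x ^ S n * RtoC q ^ S n) < 1)%R).
{ intros n; rewrite <- Cpow_mult_l; apply Cmod_pow_lt_1.
  rewrite Cmod_mult, Hqm; nra. }
assert (Hq2n : forall n, (Cmod (RtoC q ^ (2 * S n)) < 1)%R).
(* [2 * S n] reduces to the successor of this index. *)
{ intros n; exact (Hqn (n + (S n + 0))%nat). }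
assert (Hqpos : forall n, (0 < q ^ S n <= q)%R).
{ intros n; split; [apply pow_lt; lra | apply pow_le_self; lra]. }
assert (Hm : forall n, Cmod (1 - RtoC q ^ S n) = (1 - q ^ S n)%R).
{ intros n; rewrite <- RtoC_pow, <- RtoC_minus, Cmod_R.
  specialize (Hqpos n); apply Rabs_pos_eq; lra. }
assert (Hp : forall n, Cmod (1 + RtoC q ^ S n) = (1 + q ^ S n)%R).
{ intros n; rewrite <- RtoC_pow, <- RtoC_plus, Cmod_R.
  specialize (Hqpos n); apply Rabs_pos_eq; lra. }
assert (Hm0 : forall n, 1 - RtoC q ^ S n <> 0).
{ intros n; apply Cmod_gt_0; rewrite Hm; specialize (Hqpos n); lra. }
assert (Hp0 : forall n, 1 + RtoC q ^ S n <> 0).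
{ intros n; apply Cmod_gt_0; rewrite Hp; specialize (Hqpos n); lra. }
split; split.
- intros [|n] Hn; [lia|]; rewrite Hz'; now apply log_qpoch_series.
(* The constant [/ (1 - q)] comes from [1 - q^m >= 1 - q] for [m >= 1]. The rows sum to minus the
   logarithms, so the product has exponent [- s]. *)
- destruct (lambert_rearrangement f g (fun m => x ^ m / (1 - RtoC q ^ m))
    (fun n => - log_qpoch (x ^ n) (RtoC q ^ n)) (Cmod x) (/ (1 - q)))
    as [s [H1 H2]]; trivial.
  + now apply Hg.
  + intros m; rewrite Cmod_div, Cmod_pow, Hm by apply Hm0.
    unfold Rdiv; rewrite Rmult_comm; specialize (Hqpos m).
    apply Rmult_le_compat_r; [apply pow_le; lra|].
    apply Rinv_le_contravar; lra.
  + intros n; eapply is_series_ext_C; [|apply log_qpoch_series; trivial].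
    intros k; cbv beta; rewrite <- !Cpow_mult_r.
    unfold Cdiv; ring.
  + exists s; split.
    * eapply is_series_ext_C; [|exact H1]; intros n; now rewrite Hz'.
    * exists (- s); split; [|reflexivity].
      eapply is_series_ext_C; [|exact (is_series_opp _ _ H2)].
      intros n; change (opp ?y) with (- y); rewrite Hz'; ring.
- intros [|n] Hn; [lia|]; rewrite Hz', Hz1; split; apply log_qpoch_series; trivial.
(* Here [1 + q^m >= 1] allows the constant 1, and the rows sum to the logarithm of the ratio itself,
   so the exponent is [s]. *)
- destruct (lambert_rearrangement f g (fun m => x ^ m / (1 + RtoC q ^ m))
    (fun n => log_qpoch (x ^ n * RtoC q ^ n) (RtoC q ^ (2 * n))
              - log_qpoch (x ^ n) (RtoC q ^ (2 * n))) (Cmod x) 1)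
    as [s [H1 H2]]; trivial.
  + now apply Hg.
  + intros m; rewrite Cmod_div, Cmod_pow, Hp by apply Hp0.
    unfold Rdiv; rewrite Rmult_comm; specialize (Hqpos m).
    apply Rmult_le_compat_r; [apply pow_le; lra|].
    rewrite <- Rinv_1; apply Rinv_le_contravar; lra.
  + intros n.
    destruct (log_qpoch_series (x ^ S n) (RtoC q ^ (2 * S n))) as [_ Ha]; trivial.
    destruct (log_qpoch_series (x ^ S n * RtoC q ^ S n) (RtoC q ^ (2 * S n)))
      as [_ Hb]; trivial.
    replace (_ - _) with (- log_qpoch (x ^ S n) (RtoC q ^ (2 * S n))
      - - log_qpoch (x ^ S n * RtoC q ^ S n) (RtoC q ^ (2 * S n))) by ring.
    eapply is_series_ext_C; [|exact (is_series_minus _ _ _ _ Ha Hb)].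
    intros k; cbv beta; change (plus ?a (opp ?b)) with (a - b).
    rewrite Cpow_mult_l, <- !Cpow_mult_r.
    replace (2 * S n * S k)%nat with (S n * S k + S n * S k)%nat by lia.
    rewrite Cpow_add_r.
    (* The successor form fits [Hm0] and [Hp0]. With [y] the power of [q], the two expansions differ
       by the factor [(1 - y) / (1 - y^2) = 1 / (1 + y)]. *)
    replace (S n * S k)%nat with (S (k + n * S k)) by lia.
    set (y := RtoC q ^ S (k + n * S k)).
    assert (Hy1 : 1 - y <> 0) by apply Hm0.
    assert (Hy2 : 1 + y <> 0) by apply Hp0.
    replace (1 - y * y) with ((1 - y) * (1 + y)) by ring.
    field; repeat split; trivial; apply RtoC_INR_S_neq_0.
  + exists s; split.
    * eapply is_series_ext_C; [|exact H1]; intros n; now rewrite Hz'.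
    * exists s; split; [|reflexivity].
      eapply is_series_ext_C; [|exact H2].
      intros n; now rewrite Hz', Hz1.
Qed.
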